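(* Let $w\ge 1$, $s\ge w+4$, and let $L_1,\dots,L_w$ be pairwise orthogonal Latin squares of order $s$ with rows and columns indexed by $\{0,\dots,s-1\}$; let the cells $(i,j)$ be the treatments. Call two distinct cells first associates if they lie in different rows, in different columns, and carry different symbols in each $L_k$ ($k=1,\dots,w$). (1) Let $t$ be a cell and let $A_i,A_j$ be disjoint sets of cells such that $\{t\}\cup A_i$ and $\{t\}\cup A_j$ are common transversals of $L_1,\dots,L_w$. Then for every $a\in A_i$, exactly $(s-1-w)-2$ cells of $A_j$ are first associates of $a$. (2) Equivalently, in the net $N$ whose points are the cells and whose lines are the rows, the columns, and for each $k$ the $s$ sets of cells carrying a fixed symbol of $L_k$: if $\alpha_i,\alpha_j$ are transversals of $N$ with $\alpha_i\cap\alpha_j=\{P\}$, then every point of $\alpha_i$ other than $P$ is not joined in $N$ to exactly $(s-1-w)-2$ points of $\alpha_j$ other than $P$.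
   Context: Two Latin squares of order $s$ are orthogonal if superimposing them yields all $s^2$ ordered pairs of symbols. A common transversal of $L_1,\dots,L_w$ is a set of $s$ cells containing exactly one cell in each row and each column, whose $s$ cells carry $s$ distinct symbols in each $L_k$ (equivalently, a set of $s$ cells pairwise first associates). In a net, two distinct points are joined if some line contains both; a transversal of the net is a set of $s$ points no two of which are joined.
   Formalization: In part (1) it is made explicit that t belongs to neither A_i nor A_j, so that these are the transversals with t removed; without this the stated count fails (it is one too large when t lies in A_j). *)

(* Defs.v *)
From mathcomp Require Import all_boot all_order all_algebra.

Set Implicit Arguments.
Unset Strict Implicit.
Unset Printing Implicit Defensive.

(* Symbols may come from any finite type of the right size. *)
Definition latin_square (s : nat) (S : finType) (A : 'M[S]_s) : Prop :=
  [/\ #|S| = s,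
      forall (i : 'I_s) (x : S), exists! j : 'I_s, A i j = x
    & forall (j : 'I_s) (x : S), exists! i : 'I_s, A i j = x].

Definition orthogonal_squares (s : nat) (S T : finType)
    (A : 'M[S]_s) (B : 'M[T]_s) : Prop :=
  forall (x : S) (y : T), exists i j : 'I_s, A i j = x /\ B i j = y.

Definition cell (s : nat) : finType := ('I_s * 'I_s)%type.

Definition symbol_at (s : nat) (S : finType) (A : 'M[S]_s) (c : cell s) : S :=
  A c.1 c.2.

Definition first_associates (w s : nat) (S : 'I_w -> finType)
    (L : forall k : 'I_w, 'M[S k]_s) (a b : cell s) : bool :=
  [&& a.1 != b.1, a.2 != b.2
    & [forall k : 'I_w, symbol_at (L k) a != symbol_at (L k) b]].

Definition common_transversal (w s : nat) (S : 'I_w -> finType)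
    (L : forall k : 'I_w, 'M[S k]_s) (T : {set cell s}) : Prop :=
  [/\ #|T| = s,
      forall i : 'I_s, exists! c : cell s, c \in T /\ c.1 = i,
      forall j : 'I_s, exists! c : cell s, c \in T /\ c.2 = j
    & forall k : 'I_w, {in T &, injective (symbol_at (L k))}].

Definition joined (P : finType) (lines : {set {set P}}) (p q : P) : bool :=
  (p != q) && [exists l in lines, (p \in l) && (q \in l)].

Definition net_transversal (P : finType) (lines : {set {set P}}) (s : nat)
    (T : {set P}) : Prop :=
  #|T| = s /\ {in T &, forall p q : P, ~~ joined lines p q}.

Definition latin_net (w s : nat) (S : 'I_w -> finType)
    (L : forall k : 'I_w, 'M[S k]_s) : {set {set cell s}} :=
  [set [set c : cell s | c.1 == i] | i : 'I_s]
  :|: [set [set c : cell s | c.2 == j] | j : 'I_s]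
  :|: \bigcup_(k < w) [set [set c : cell s | symbol_at (L k) c == x] | x : S k].

(* Main.v *)
Require Import Defs.
From mathcomp Require Import all_boot all_order all_algebra.

Set Implicit Arguments.
Unset Strict Implicit.
Unset Printing Implicit Defensive.

(** A net with w + 2 parallel classes: the line of each class through a point
    [a] outside a transversal [T] meets [T] in exactly one point, and lines of
    different classes through [a] meet only in [a].  Hence [a] is joined to
    exactly w + 2 of the s points of [T].  When [a] lies on a second transversal
    through [t \in T], the point [t] is one of the s - (w + 2) points not joined
    to [a], and discarding it leaves s - w - 3. *)

Lemma card_avoid_transversal (P K : finType) (X : K -> finType)
    (c : forall k, P -> X k) (T : {set P}) (a : P) :
  (forall k, #|X k| = #|T|) -> (forall k, {in T &, injective (c k)}) ->
  (forall k l b, k != l -> c k a = c k b -> c l a = c l b -> a = b) ->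
  a \notin T ->
  #|[set b in T | [forall k, c k a != c k b]]| = #|T| - #|K|.
Proof.
move=> cardX injc sep aT.
(* Pigeonhole: [c k] is injective on [T] and [X k] has exactly [#|T|] elements, so [c k] maps [T]
   onto [X k], and in particular takes the value [c k a] on [T]. *)
have meet k : exists2 b, b \in T & c k a = c k b.
  apply/imsetP.
  suff -> : c k @: T = [set: X k] by rewrite inE.
  by apply/eqP; rewrite eqEcard subsetT cardsT card_in_imset // cardX leqnn.
pose m k := s2val (sig2_eqW (meet k)).
have mT k : m k \in T by rewrite /m; case: sig2_eqW.
have mE k : c k a = c k (m k) by rewrite /m; case: sig2_eqW.
(* If the lines of two classes through [a] met [T] in the same point, [sep] would identify that
   point with [a], which is outside [T]. *)
have m_inj : injective m.
  move=> k l eq_m; apply/eqP; apply: contraNT aT => neq_kl.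
  by rewrite (sep k l (m k)) ?mT // eq_m -mE.
have -> : [set b in T | [forall k, c k a != c k b]] = T :\: (m @: K).
  apply/setP=> b; rewrite !inE andbC; case bT: (b \in T); rewrite ?andbF //.
  rewrite !andbT; apply/forallP/negP => [avoid /imsetP[k _ eq_b] | avoid k].
    by have := avoid k; rewrite eq_b -mE eqxx.
  apply/eqP=> eq_c; apply: avoid; apply/imsetP; exists k => //.
  by apply: (injc k) => //; rewrite -eq_c.
have sub_mT : m @: K \subset T by apply/subsetP=> _ /imsetP[k _ ->].
by rewrite cardsD (setIidPr sub_mT) card_imset.
Qed.

(** Superimposition is a surjection from the s^2 cells onto the s^2 pairs of symbols, hence a
    bijection. *)
Lemma orthogonal_squares_inj (s : nat) (S T : finType)
    (A : 'M[S]_s) (B : 'M[T]_s) (a b : cell s) :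
  #|S| = s -> #|T| = s -> orthogonal_squares A B ->
  symbol_at A a = symbol_at A b -> symbol_at B a = symbol_at B b -> a = b.
Proof.
move=> cardS cardT orth eqA eqB.
pose f (c : cell s) := (symbol_at A c, symbol_at B c).
have f_onto : f @: [set: cell s] = [set: S * T].
  apply/setP=> -[x y]; rewrite inE; apply/imsetP.
  by have [i [j [<- <-]]] := orth x y; exists (i, j).
have /imset_injP f_inj : #|f @: [set: cell s]| == #|[set: cell s]|.
  by rewrite f_onto !cardsT !card_prod cardS cardT card_ord.
by apply: f_inj; rewrite ?inE // /f eqA eqB.
Qed.

Section LatinNet.

Variables (w s : nat) (S : 'I_w -> finType) (L : forall k : 'I_w, 'M[S k]_s).

(* Parallel classes: [None] for the rows, [Some None] for the columns and
   [Some (Some k)] for the symbols of [L k]. *)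
Definition coord_type (k : option (option 'I_w)) : finType :=
  match k with Some (Some i) => S i | _ => 'I_s end.

(** Lines are encoded as fibres of [coord k], so that rows, columns and symbols are handled
    uniformly. *)
Definition coord (k : option (option 'I_w)) : cell s -> coord_type k :=
  match k with
  | None => fun a => a.1
  | Some None => fun a => a.2
  | Some (Some i) => symbol_at (L i)
  end.

Lemma first_associatesE (a b : cell s) :
  first_associates L a b = [forall k, coord k a != coord k b].
Proof.
apply/and3P/forallP => [[row col /forallP sym] [[k|]|] // | neq].
  exact: sym.
split; [exact: (neq None) | exact: (neq (Some None)) | apply/forallP=> k].
exact: (neq (Some (Some k))).
Qed.

Lemma joinedE (a b : cell s) :
  joined (latin_net L) a b = (a != b) && [exists k, coord k a == coord k b].
Proof.
rewrite /joined; congr (_ && _); apply/exists_inP/existsP => [[l] | [k /eqP eq_c]].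
  rewrite !inE -orbA => /or3P[/imsetP[i _ ->] | /imsetP[j _ ->] |].
  - by rewrite !inE => /andP[/eqP a1 /eqP b1]; exists None; rewrite /= a1 b1.
  - by rewrite !inE => /andP[/eqP a2 /eqP b2]; exists (Some None); rewrite /= a2 b2.
  case/bigcupP=> k _ /imsetP[x _ ->]; rewrite !inE => /andP[/eqP ak /eqP bk].
  by exists (Some (Some k)); rewrite /= ak bk.
case: k eq_c => [[k|]|] /= eq_c.
- exists [set c | symbol_at (L k) c == symbol_at (L k) a].
    rewrite !inE; apply/orP; right; apply/bigcupP; exists k => //.
    exact: imset_f.
  by rewrite !inE eq_c eqxx.
- exists [set c : cell s | c.2 == a.2]; last by rewrite !inE eq_c eqxx.
  by rewrite !inE; apply/orP; left; apply/orP; right; apply: imset_f.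
exists [set c : cell s | c.1 == a.1]; last by rewrite !inE eq_c eqxx.
by rewrite !inE; apply/orP; left; apply/orP; left; apply: imset_f.
Qed.

(** Both notions of transversal enter the count only through their size and this injectivity, so a
    single count serves for both parts of the theorem. *)
Lemma common_transversal_inj (T : {set cell s}) k :
  common_transversal L T -> {in T &, injective (coord k)}.
Proof.
case=> _ row col sym; case: k => [[k|]|] a b aT bT /= eq_ab.
- exact: (sym k).
- by have [c [_ uniq_c]] := col a.2; rewrite -(uniq_c a) // -(uniq_c b).
- by have [c [_ uniq_c]] := row a.1; rewrite -(uniq_c a) // -(uniq_c b).
Qed.

Lemma net_transversal_inj (T : {set cell s}) k :
  net_transversal (latin_net L) s T -> {in T &, injective (coord k)}.
Proof.
case=> _ unjoined a b aT bT eq_ab; apply/eqP.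
apply: contraNT (unjoined a b aT bT) => neq_ab.
by rewrite joinedE neq_ab; apply/existsP; exists k; apply/eqP.
Qed.

Hypothesis L_latin : forall k : 'I_w, latin_square (L k).
Hypothesis L_orth :
  forall k l : 'I_w, k != l -> orthogonal_squares (L k) (L l).

Lemma card_coord_type k : #|coord_type k| = s.
Proof. by case: k => [[k|]|] /=; rewrite ?card_ord //; case: (L_latin k). Qed.

Lemma row_symbol_inj (i : 'I_w) (a b : cell s) :
  a.1 = b.1 -> symbol_at (L i) a = symbol_at (L i) b -> a = b.
Proof.
case: a b => [a1 a2] [b1 b2]; rewrite /symbol_at /= => <- eq_i.
have [_ rowP _] := L_latin i.
have [j [_ uniq_j]] := rowP a1 (L i a1 a2).
by rewrite -(uniq_j a2) // -(uniq_j b2).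
Qed.

Lemma col_symbol_inj (i : 'I_w) (a b : cell s) :
  a.2 = b.2 -> symbol_at (L i) a = symbol_at (L i) b -> a = b.
Proof.
case: a b => [a1 a2] [b1 b2]; rewrite /symbol_at /= => <- eq_i.
have [_ _ colP] := L_latin i.
have [j [_ uniq_j]] := colP a2 (L i a1 a2).
by rewrite -(uniq_j a1) // -(uniq_j b1).
Qed.

(** Lines of different parallel classes share at most one cell: by orthogonality for two squares, by
    the Latin property for a square with a row or column, and trivially for a row with a column. *)
Lemma coord_pair_inj k l (a b : cell s) :
  k != l -> coord k a = coord k b -> coord l a = coord l b -> a = b.
Proof.
case: k l => [[k|]|] [[l|]|] //= neq_kl eq_k eq_l.
- have [cardk _ _] := L_latin k; have [cardl _ _] := L_latin l.
  exact: orthogonal_squares_inj cardk cardl (L_orth neq_kl) eq_k eq_l.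
- exact: col_symbol_inj eq_l eq_k.
- exact: row_symbol_inj eq_l eq_k.
- exact: col_symbol_inj eq_k eq_l.
- by case: a b eq_k eq_l => [? ?] [? ?] /= -> ->.
- exact: row_symbol_inj eq_k eq_l.
- by case: a b eq_k eq_l => [? ?] [? ?] /= -> ->.
Qed.

Lemma card_transversal_first_associates (T : {set cell s}) (t a : cell s) :
  #|T| = s -> (forall k, {in T &, injective (coord k)}) ->
  t \in T -> a \notin T -> first_associates L a t ->
  #|[set b in T :\ t | first_associates L a b]| = (s - 1 - w) - 2.
Proof.
move=> cardT injT tT aT assoc_at.
have -> : [set b in T :\ t | first_associates L a b]
        = [set b in T | [forall k, coord k a != coord k b]] :\ t.
  by apply/setP=> b; rewrite !inE -first_associatesE andbA.
have := @card_avoid_transversal _ _ coord_type coord T a.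
rewrite cardT => /(_ card_coord_type injT) cardE.
have {cardE} := cardE (fun k l b => @coord_pair_inj k l a b) aT.
(* The index type has w + 2 elements, one per parallel class. Splitting off [t] turns the count into
   1 + n = s - (w + 2); taking predecessors gives n = s - (w + 3), also as truncated subtraction. *)
rewrite (cardsD1 t) inE tT -first_associatesE assoc_at !card_option card_ord.
by rewrite add1n => /(congr1 predn) /= ->; rewrite -subnS -!subnDA !addnS addn0.
Qed.

Lemma transversal_first_associates (T : {set cell s}) (a b : cell s) :
  (forall k, {in T &, injective (coord k)}) -> a \in T -> b \in T -> a != b ->
  first_associates L a b.
Proof.
move=> injT aT bT neq_ab; rewrite first_associatesE; apply/forallP=> k.
by apply: contraNneq neq_ab => /(injT k a b aT bT) ->.
Qed.

Lemma first_associates_joined (a b : cell s) :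
  a != b -> first_associates L a b = ~~ joined (latin_net L) a b.
Proof.
by move=> neq_ab; rewrite joinedE neq_ab first_associatesE negb_exists.
Qed.

End LatinNet.

Theorem theorem3p9 (w s : nat) (w_ge1 : 1 <= w) (s_ge : w + 4 <= s)
    (S : 'I_w -> finType) (L : forall k : 'I_w, 'M[S k]_s)
    (L_latin : forall k : 'I_w, latin_square (L k))
    (L_orth : forall k l : 'I_w, k != l -> orthogonal_squares (L k) (L l)) :
  (forall (t : cell s) (Ai Aj : {set cell s}),
      t \notin Ai -> t \notin Aj -> [disjoint Ai & Aj] ->
      common_transversal L (t |: Ai) -> common_transversal L (t |: Aj) ->
      forall a : cell s, a \in Ai ->
        #|[set b in Aj | first_associates L a b]| = (s - 1 - w) - 2)
  /\
  (forall (P : cell s) (alphai alphaj : {set cell s}),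
      net_transversal (latin_net L) s alphai ->
      net_transversal (latin_net L) s alphaj ->
      alphai :&: alphaj = [set P] ->
      forall a : cell s, a \in alphai :\ P ->
        #|[set b in alphaj :\ P | ~~ joined (latin_net L) a b]|
          = (s - 1 - w) - 2).
Proof.
split=> [t Ai Aj tAi tAj disj trAi trAj a aAi | P alphai alphaj tri trj capE a].
  have neq_at : a != t by apply: contraNneq tAi => <-.
  have aAj : a \notin Aj by rewrite (disjointFr disj).
  have -> : Aj = (t |: Aj) :\ t by rewrite setU1K.
  apply: card_transversal_first_associates => //.
  - by case: trAj.
  - by move=> k; apply: common_transversal_inj.
  - exact: setU11.
  - by rewrite !inE negb_or neq_at.
  (* The other transversal is used only here: it contains both [a] and [t], so they are first
     associates. *)
  apply: (@transversal_first_associates _ _ _ _ (t |: Ai)) => //.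
  - by move=> k; apply: common_transversal_inj.
  - by rewrite !inE aAi orbT.
  - exact: setU11.
case/setD1P=> neq_aP ai.
have /setIP[Pi Pj] : P \in alphai :&: alphaj by rewrite capE set11.
have aj : a \notin alphaj.
  by apply: contraNN neq_aP => aj; rewrite -in_set1 -capE inE ai.
(* Being not joined agrees with being first associates only for distinct points; here [b] lies in
   [alphaj] and [a] does not. *)
have -> : [set b in alphaj :\ P | ~~ joined (latin_net L) a b]
        = [set b in alphaj :\ P | first_associates L a b].
  apply/setP=> b; rewrite [in LHS]inE [in RHS]inE.
  case bj: (b \in alphaj :\ P) => //=.
  rewrite first_associates_joined //; apply: contraNneq aj => ->.
  by case/setD1P: bj.
apply: card_transversal_first_associates => //.
- by case: trj.
- by move=> k; apply: net_transversal_inj.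
apply: (@transversal_first_associates _ _ _ _ alphai) => // k.
exact: net_transversal_inj.
Qed.
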